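(* Let $X$ be a Cantor set and let $\mathcal{G}\subset\mathrm{Homeo}(X)$ be an ample group that acts minimally on $X$ and has Property E. Suppose $Y\subset X$ is an infinite closed set that is nowhere dense in $X$. Then the stabilizer $\mathrm{St}_{\mathcal{G}}(Y)$ is a maximal subgroup of $\mathcal{G}$ if and only if it acts minimally when restricted to $Y$.
   Context: $\mathrm{Homeo}(X)$ is the group of all homeomorphisms of $X$. For a group $G\subset\mathrm{Homeo}(X)$, its full amplification $\mathsf{F}(G)$ is the group of all homeomorphisms $f$ of $X$ such that every point $x\in X$ has an open neighborhood $U_x$ on which $f$ coincides with some element of $G$. The group $G$ is called ample if $\mathsf{F}(G)=G$. A group acting by homeomorphisms on a space acts minimally if the only closed invariant subsets are the empty set and the whole space. For a clopen (closed and open) set $U\subset X$, the local subgroup $\mathcal{G}_U$ consists of all $g\in\mathcal{G}$ such that $g(x)=x$ for all $x\notin U$. Property E for the ample group $\mathcal{G}$: for any clopen sets $U_1,U_2\subset X$ with $U_1\cap U_2\ne\emptyset$, the group $\mathcal{G}_{U_1\cup U_2}$ is generated by $\mathcal{G}_{U_1}\cup\mathcal{G}_{U_2}$. $\mathrm{St}_{\mathcal{G}}(Y)=\{g\in\mathcal{G}\mid g(Y)=Y\}$. A maximal subgroup of $\mathcal{G}$ is a proper subgroup $H$ such that there is no subgroup $K$ with $H\subsetneq K\subsetneq\mathcal{G}$. *)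

(* Defs.v *)
From HB Require Import structures.
From mathcomp Require Import all_boot.
From mathcomp Require Import boolp classical_sets functions cardinality.
From mathcomp Require Import topology cantor.

Set Implicit Arguments.
Unset Strict Implicit.
Unset Printing Implicit Defensive.

Local Open Scope classical_set_scope.

Definition cantor_set (X : topologicalType) : Prop :=
  exists (f : X -> cantor_space) (g : cantor_space -> X),
    [/\ continuous f, continuous g, cancel f g & cancel g f].

Record Homeo (X : topologicalType) := MkHomeo {
  homeo_fun :> X -> X;
  homeo_inv : X -> X;
  homeo_funK : cancel homeo_fun homeo_inv;
  homeo_invK : cancel homeo_inv homeo_fun;
  homeo_fun_continuous : continuous homeo_fun;
  homeo_inv_continuous : continuous homeo_inv
}.

HB.instance Definition _ (X : topologicalType) := gen_eqMixin (Homeo X).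
HB.instance Definition _ (X : topologicalType) := gen_choiceMixin (Homeo X).

Section HomeoGroup.
Variable X : topologicalType.
Implicit Types f g h : Homeo X.

Lemma homeoP f g : f =1 g -> f = g.
Proof.
case: f g => [f f' fK f'K cf cf'] [g g' gK g'K cg cg'] /= fg.
have {}fg : f = g by exact/funext.
subst g; have fg' : f' = g' by apply/funext => x; rewrite -[in LHS](g'K x) fK.
subst g'; congr MkHomeo; exact: Prop_irrelevance.
Qed.

Lemma homeo_id_continuous : continuous (@idfun X).
Proof. by move=> x; exact: cvg_id. Qed.

Definition homeo_one : Homeo X :=
  @MkHomeo X idfun idfun (fun=> erefl) (fun=> erefl)
    homeo_id_continuous homeo_id_continuous.

Definition homeo_opp f : Homeo X :=
  MkHomeo (@homeo_invK X f) (@homeo_funK X f)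
    (@homeo_inv_continuous X f) (@homeo_fun_continuous X f).

Lemma homeo_comp_continuous f g : continuous (f \o g).
Proof.
by move=> x; apply: continuous_comp; exact: homeo_fun_continuous.
Qed.

Definition homeo_mul f g : Homeo X :=
  MkHomeo (can_comp (@homeo_funK X f) (@homeo_funK X g))
    (can_comp (@homeo_invK X g) (@homeo_invK X f))
    (@homeo_comp_continuous f g)
    (@homeo_comp_continuous (homeo_opp g) (homeo_opp f)).

Lemma homeo_mulA : associative homeo_mul.
Proof. by move=> f g h; exact: homeoP. Qed.

Lemma homeo_mul1 : left_id homeo_one homeo_mul.
Proof. by move=> f; exact: homeoP. Qed.

Lemma homeo_mulr1 : right_id homeo_one homeo_mul.
Proof. by move=> f; exact: homeoP. Qed.

Lemma homeo_mulV : left_inverse homeo_one homeo_opp homeo_mul.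
Proof. by move=> f; apply: homeoP => x; exact: homeo_funK. Qed.

Lemma homeo_mulrV : right_inverse homeo_one homeo_opp homeo_mul.
Proof. by move=> f; apply: homeoP => x; exact: homeo_invK. Qed.

HB.instance Definition _ := isGroup.Build (Homeo X)
  homeo_mulA homeo_mul1 homeo_mulr1 homeo_mulV homeo_mulrV.

End HomeoGroup.

Section Subgroups.
Variable gT : groupType.
Implicit Types H K G A : set gT.

Definition subgroup H : Prop := group_closed (mem H).

Definition generated A : set gT := smallest subgroup A.

Definition maximal_subgroup G H : Prop :=
  [/\ subgroup H, H `<` G
    & ~ exists K, [/\ subgroup K, H `<` K & K `<` G]].

End Subgroups.

Section Actions.
Variable X : topologicalType.
Implicit Types (G : set (Homeo X)) (U Y A : set X).

Definition nowhere_dense Y : Prop := interior (closure Y) = set0.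

Definition full_amplification G : set (Homeo X) :=
  [set f | forall x : X, exists U : set X,
     [/\ open U, U x
       & exists2 g : Homeo X, G g & forall y, U y -> f y = g y]].

Definition ample G : Prop := full_amplification G = G.

(* [Y] is meant to be invariant under [G]; closedness of [A] is taken in the
   subspace topology of [Y], which is that of [X] when [Y] is [setT]. *)
Definition acts_minimally_on G Y : Prop :=
  forall A, A `<=` Y -> closed (A : set (subspace Y)) ->
    (forall g, G g -> g @` A = A) -> A = set0 \/ A = Y.

Definition acts_minimally G : Prop := acts_minimally_on G [set: X].

Definition local_subgroup G U : set (Homeo X) :=
  [set g | G g /\ forall x, ~ U x -> g x = x].

Definition property_E G : Prop :=
  forall U1 U2, clopen U1 -> clopen U2 -> U1 `&` U2 !=set0 ->
    local_subgroup G (U1 `|` U2)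
    = generated (local_subgroup G U1 `|` local_subgroup G U2).

Definition stabilizer G Y : set (Homeo X) := [set g | G g /\ g @` Y = Y].

End Actions.

(* Main.v *)
(** For the direct implication, let [A] be a proper nonempty closed subset of
    [Y] invariant under [St(Y)].  Maximality forces [St(A) = St(Y)]; but near a
    point [y] of [Y \ A] one can exchange a small clopen neighbourhood of [y]
    with its image under an element of [G] moving [y] off [Y], and this
    involution fixes [A] pointwise without preserving [Y].

    For the converse, let [K] be a subgroup strictly containing [St(Y)] and
    consider the clopen sets [U] with [G_U <= K].  They include all clopen sets
    disjoint from [Y], and they are permuted by [K].  Since some element of [K]
    moves a point of [Y] off [Y], minimality on [Y] shows that they cover [X].
    As [Y] has empty interior, any two of them can be linked by a third one
    disjoint from [Y], so Property E makes them stable under unions, and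
    compactness gives [G = G_X <= K]. *)
Require Import Defs.
From HB Require Import structures.
From mathcomp Require Import all_boot.
From mathcomp Require Import boolp classical_sets functions cardinality.
From mathcomp Require Import topology cantor.

Local Open Scope classical_set_scope.

(** * Compactness and clopen sets in a Cantor set *)

(** If [P] missed the whole space, complements of its members would form a base of a proper filter;
    a cluster point of that filter has a neighbourhood in [P], which meets its own complement. *)
Lemma compact_ideal {X : topologicalType} {P : set (set X)} :
  compact [set: X] -> P set0 -> setU_closed P ->
  (forall x : X, exists2 V, P V & nbhs x V) -> P [set: X].
Proof.
move=> cX P0 PU Pcov; apply: contrapT => nPT.
pose F : set_system X := filter_from P (fun U => ~` U).
have FF : ProperFilter F.
  apply: filter_from_proper; first apply: filter_from_filter.
  - by exists set0.
  - by move=> U V PUx PVx; exists (U `|` V); [exact: PU | rewrite setCU].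
  - move=> U PUx; apply/set0P/eqP => UC0; apply: nPT.
    by rewrite -(setCK U) UC0 setC0 in PUx.
have [x [_ Fx]] := cX F FF filterT.
have [V PV Vx] := Pcov x.
have FV : F (~` V) by exists V.
by have [z [nVz Vz]] := Fx _ _ FV Vx.
Qed.

Lemma cantor_set_compact {X : topologicalType} :
  cantor_set X -> compact [set: X].
Proof.
move=> [f [g [cf cg fK gK]]].
have -> : [set: X] = g @` [set: cantor_space].
  by apply/seteqP; split=> // x _; exists (f x).
apply: continuous_compact; last exact: cantor_space_compact.
exact: continuous_subspaceT.
Qed.

Lemma cantor_set_clopen_nbhs {X : topologicalType} {x : X} {U : set X} :
  cantor_set X -> nbhs x U -> exists V, [/\ clopen V, V x & V `<=` U].
Proof.
move=> [f [g [cf cg fK gK]]] xU.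
have gU : nbhs (f x) (g @^-1` U) by apply: cg; rewrite fK.
have [D [Dfx clD] DU] :
    filter_from [set D | D (f x) /\ clopen D] id (g @^-1` U).
  exact: (zero_dimensional_cvg cantor_space_hausdorff cantor_zero_dimensional
    cantor_space_compact) gU.
exists (f @^-1` D); split => //; first exact: preimage_clopen.
by move=> z Dz; rewrite -(fK z); exact: DU.
Qed.

(** * Subgroups and stabilizers *)

Section Subgroup.
Context {gT : groupType} {H : set gT}.
Hypothesis sgH : subgroup H.

Lemma subgroup1 : H 1%g.
Proof. by have [/set_mem] := sgH. Qed.

Lemma subgroupV {x} : H x -> H x^-1%g.
Proof. by move=> Hx; apply/set_mem/(group_closedV sgH)/mem_set. Qed.

Lemma subgroupM {x y} : H x -> H y -> H (x * y)%g.
Proof. by move=> Hx Hy; apply/set_mem/(group_closedM sgH); exact/mem_set. Qed.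

End Subgroup.

Lemma invariant_image {X : topologicalType} {H : set (Homeo X)} {A : set X} :
  subgroup H -> (forall g x, H g -> A x -> A (g x)) ->
  forall g, H g -> g @` A = A.
Proof.
move=> sgH HA g Hg; apply/seteqP; split=> [_ [x Ax <-]|x Ax]; first exact: HA.
by exists (g^-1%g x); [apply: HA => //; exact: subgroupV | exact: homeo_invK].
Qed.

Lemma stabilizer_subgroup {X : topologicalType} {G : set (Homeo X)}
  {Y : set X} : subgroup G -> subgroup (stabilizer G Y).
Proof.
move=> sgG; split=> [|g h /set_mem[Gg gY] /set_mem[Gh hY]]; apply/mem_set.
  by split; [exact: subgroup1 | exact: image_id].
split; first by apply: subgroupM => //; exact: subgroupV.
(* Closure is tested on quotients: with [Y] written as [h(Y)], the map [g * h^-1] sends it to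
   [g(Y)]. *)
rewrite -[in RHS]gY -[in LHS]hY image_comp; apply: eq_imagel => x _ /=.
by congr (g _); exact: homeo_funK.
Qed.

(** * Orbits, nowhere density and swaps *)

(** The points of [Y] whose whole orbit avoids [U] form a closed invariant set missing [y0], so
    minimality makes it empty. *)
Lemma minimal_orbit {X : topologicalType} {H : set (Homeo X)}
    {Y U : set X} {y0 y : X} :
  subgroup H -> (forall h x, H h -> Y x -> Y (h x)) ->
  acts_minimally_on H Y -> open U -> Y y0 -> U y0 -> Y y ->
  exists2 h, H h & U (h y).
Proof.
move=> sgH HY Hmin oU Yy0 Uy0 Yy.
pose A := Y `&` \bigcap_(h in H) ~` (homeo_fun h @^-1` U).
have cA : closed (A : set (subspace Y)).
  apply/closed_subspaceP; exists (\bigcap_(h in H) ~` (homeo_fun h @^-1` U)).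
    apply: closed_bigI => h Hh; apply: open_closedC.
    by apply: open_comp => // x _; exact: homeo_fun_continuous.
  by rewrite /A setIAC setIid setIC.
have AH g x : H g -> A x -> A (g x).
  move=> Hg [Yx nUx]; split; first exact: HY.
  by move=> h Hh; exact: nUx (h * g)%g (subgroupM sgH Hh Hg).
have [A0|AY] := Hmin A (@subIsetl _ _ _) cA (invariant_image sgH AH).
  apply: contrapT => nU; suff : A y by rewrite A0.
  by split=> // h Hh Uhy; apply: nU; exists h.
have : A y0 by rewrite AY.
by case=> _ /(_ _ (subgroup1 sgH)).
Qed.

Lemma nowhere_dense_open {X : topologicalType} {Y U : set X} :
  nowhere_dense Y -> open U -> U !=set0 -> exists2 x, U x & ~ Y x.
Proof.
move=> ndY oU [x Ux]; apply: contrapT => UY.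
suff : interior (closure Y) x by rewrite ndY.
have : U `<=` interior (closure Y); last by apply.
rewrite -open_subsetE // => z Uz.
by apply: subset_closure; apply: contrapT => nYz; apply: UY; exists z.
Qed.

Lemma locally_homeo_continuous {X : topologicalType} {f : X -> X} :
  (forall x, exists U, [/\ open U, U x
     & exists g : Homeo X, forall y, U y -> f y = g y]) ->
  continuous f.
Proof.
move=> fP x; have [U [oU Ux [g fg]]] := fP x.
rewrite /continuous_at (fg _ Ux).
apply: (cvg_trans _ (@homeo_fun_continuous _ g x)); apply: near_eq_cvg.
by apply: filterS (open_nbhs_nbhs (conj oU Ux)) => y /fg->.
Qed.

(** Take [g] on [V], its inverse on [g(V)] and the identity elsewhere. These three pieces are clopen
    and disjoint, so the involution agrees locally with elements of [G] and ampleness applies. *)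
Lemma exists_swap {X : topologicalType} {G : set (Homeo X)} {g : Homeo X}
    {V : set X} :
  subgroup G -> ample G -> G g -> clopen V -> (forall x, V x -> ~ V (g x)) ->
  exists h, [/\ G h, forall x, V x -> h x = g x
    & forall x, ~ V x -> ~ V (homeo_inv g x) -> h x = x].
Proof.
move=> sgG aG Gg clV Vg.
(* This is [g(V)], written as a preimage so that it is clopen by continuity. *)
pose W := homeo_inv g @^-1` V.
have clW : clopen W by apply: preimage_clopen; last exact: homeo_inv_continuous.
pose f x := if `[< V x >] then g x
            else if `[< W x >] then homeo_inv g x else x.
have fV x : V x -> f x = g x by rewrite /f => Vx; case: asboolP.
have fW x : W x -> f x = homeo_inv g x.
  rewrite /f => Wx; case: asboolP => [Vx|_]; last by case: asboolP.
  by case: (Vg _ Wx); rewrite homeo_invK.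
have f1 x : ~ V x -> ~ W x -> f x = x.
  by rewrite /f => nVx nWx; case: asboolP => // _; case: asboolP.
have fK : cancel f f.
  move=> x; have [Vx|nVx] := pselect (V x).
    by rewrite (fV _ Vx) fW /W /preimage /= homeo_funK.
  have [Wx|nWx] := pselect (W x); last by rewrite !(f1 _ nVx nWx).
  by rewrite (fW _ Wx) fV // homeo_invK.
have fG x : exists U, [/\ open U, U x
    & exists2 k : Homeo X, G k & forall y, U y -> f y = k y].
  have [Vx|nVx] := pselect (V x).
    by exists V; split; [exact: clV.1 | | exists g].
  have [Wx|nWx] := pselect (W x).
    exists W; split; [exact: clW.1 | by [] | exists g^-1%g => //].
    exact: subgroupV.
  exists (~` V `&` ~` W); split => //.
    by apply: openI; apply: closed_openC; [exact: clV.2 | exact: clW.2].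
  by exists 1%g; [exact: subgroup1 | move=> y [/f1]; apply].
have fc : continuous f.
  apply: locally_homeo_continuous => x; have [U [oU Ux [k _ fk]]] := fG x.
  by exists U; split=> //; exists k.
by exists (@MkHomeo X f f fK fK fc fc); split=> //; rewrite -aG.
Qed.

(** * From maximality to minimality on [Y] *)

Lemma stabilizer_min_of_maximal {X : topologicalType} {G : set (Homeo X)}
    {Y : set X} :
  cantor_set X -> subgroup G -> ample G -> acts_minimally G ->
  closed Y -> nowhere_dense Y ->
  maximal_subgroup G (stabilizer G Y) ->
  acts_minimally_on (stabilizer G Y) Y.
Proof.
move=> XC sgG aG Gmin cY ndY [_ _ maxY] A AY cA AH.
have {}cA : closed A by rewrite -(setIidl AY) closed_setIS.
apply: contrapT => /not_orP[A0 AneY]; apply: maxY.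
exists (stabilizer G A); split; first exact: stabilizer_subgroup.
- split=> [g gY|sAY]; first by split; [case: gY | exact: AH].
  have [y Yy nAy] : exists2 y, Y y & ~ A y.
    apply: contrapT => nex; apply: AneY; apply/seteqP; split=> // y Yy.
    by apply: contrapT => nAy; apply: nex; exists y.
  have oA : open (~` A) by exact: closed_openC.
  have oY : open (~` Y) by exact: closed_openC.
  have [z nAz nYz] := nowhere_dense_open ndY oA (ex_intro _ y nAy).
  have [g Gg [nAgy nYgy]] : exists2 g, G g & (~` A `&` ~` Y) (g y).
    by apply: (minimal_orbit (y0 := z) sgG _ Gmin (openI oA oY)).
  have [B [clB Bgy BY]] := cantor_set_clopen_nbhs XC
    (open_nbhs_nbhs (conj (openI oA oY) (conj nAgy nYgy))).
  have nBy : ~ B y by move=> /BY[].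
  (* Since [g(V)] lies in [B], the sets [V] and [g(V)] are disjoint and both miss [A]: swapping them
     fixes [A] pointwise but sends [y] to [g y], off [Y]. *)
  have [V [clV Vy VP]] : exists V, [/\ clopen V, V y
      & V `<=` (~` A `&` ~` B) `&` homeo_fun g @^-1` B].
    apply: cantor_set_clopen_nbhs => //; apply: filterI.
      apply: open_nbhs_nbhs; split=> //; apply: openI => //.
      by apply: closed_openC; exact: clB.2.
    by apply: homeo_fun_continuous; apply: open_nbhs_nbhs; split=> //; exact: clB.1.
  have [|h [Gh hV h1]] := exists_swap sgG aG Gg clV.
    by move=> x /VP[_ Bgx] /VP[[_]].
  have hA x : A x -> h x = x.
    move=> Ax; apply: h1 => [/VP[[]]//|/VP[_]] /=.
    by rewrite homeo_invK => /BY[].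
  have [_ hY] : stabilizer G Y h.
    apply: sAY; split=> //; apply/seteqP; split=> [_ [x Ax <-]|x Ax].
      by rewrite hA.
    by exists x => //; exact: hA.
  by apply: nYgy; rewrite -(hV _ Vy) -[X in X _]hY; exists y.
(* If [St(A)] were all of [G], then [A] would be invariant under [G], hence empty or all of [X]. *)
- split=> [g []//|GA].
  case: (Gmin A) => //.
  - by rewrite -(closed_setIS A closedT) setIT.
  - by move=> g /GA[].
  - by move=> AT; apply: AneY; apply/seteqP; split=> //; rewrite AT.
Qed.

(** * From minimality on [Y] to maximality *)

(** Conjugation by [k] turns an element supported in the preimage of [U] into one supported in
    [U]. *)
Lemma local_subgroup_preimage {X : topologicalType} {G K : set (Homeo X)}
    {k : Homeo X} {U : set X} :
  subgroup G -> subgroup K -> K `<=` G -> K k ->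
  local_subgroup G U `<=` K ->
  local_subgroup G (homeo_fun k @^-1` U) `<=` K.
Proof.
move=> sgG sgK KG Kk UK h [Gh h1].
have Kk' := subgroupV sgK Kk.
have Kc : K (k * h * k^-1)%g.
  apply: UK; split.
    by apply: (subgroupM sgG); [apply: (subgroupM sgG) => // |]; exact: KG.
  move=> x nUx; rewrite [LHS](_ : _ = k (h (homeo_inv k x))) //.
  by rewrite h1 /preimage /= homeo_invK.
suff -> : h = (k^-1 * (k * h * k^-1) * k)%g.
  by apply: (subgroupM sgK) => //; exact: (subgroupM sgK).
by rewrite !mulgA mulVg mul1g -mulgA mulVg mulg1.
Qed.

Lemma local_subgroupU {X : topologicalType} {G K : set (Homeo X)}
    {U V : set X} :
  property_E G -> subgroup K -> clopen U -> clopen V -> U `&` V !=set0 ->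
  local_subgroup G U `<=` K -> local_subgroup G V `<=` K ->
  local_subgroup G (U `|` V) `<=` K.
Proof.
move=> EG sgK clU clV UV UK VK; rewrite (EG _ _ clU clV UV).
by apply: smallest_sub => // g [/UK|/VK].
Qed.

Lemma local_subgroup_stabilizer {X : topologicalType} {G : set (Homeo X)}
    {U Y : set X} :
  U `<=` ~` Y -> local_subgroup G U `<=` stabilizer G Y.
Proof.
move=> UY g [Gg g1]; split=> //.
have gY y : Y y -> g y = y by move=> Yy; apply: g1 => /UY.
apply/seteqP; split=> [_ [y Yy <-]|y Yy]; first by rewrite gY.
by exists y => //; exact: gY.
Qed.

Lemma stabilizer_maximal_of_min {X : topologicalType} {G : set (Homeo X)}
    {Y : set X} :
  cantor_set X -> subgroup G -> acts_minimally G -> property_E G ->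
  Y !=set0 -> closed Y -> nowhere_dense Y ->
  acts_minimally_on (stabilizer G Y) Y ->
  maximal_subgroup G (stabilizer G Y).
Proof.
move=> XC sgG Gmin EG [y1 Yy1] cY ndY Hmin.
have sgH : subgroup (stabilizer G Y) by exact: stabilizer_subgroup.
have oY : open (~` Y) by exact: closed_openC.
split=> //.
  split=> [g []//|GY].
  case: (Gmin Y) => //.
  - by rewrite -(closed_setIS Y closedT) setIT.
  - by move=> g /GY[].
  - by move=> Y0; rewrite Y0 in Yy1.
  - move=> YT; have [|x _] := nowhere_dense_open ndY (@openT X).
      by exists y1.
    by rewrite YT; apply.
move=> [K [sgK [HK KH] [KG GK]]].
have [k [Kk [y0 [Yy0 nYky0]]]] :
    exists k, K k /\ exists y, Y y /\ ~ Y (homeo_fun k y).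
  (* Otherwise every element of [K] maps [Y] into itself; as [K] contains inverses, it would lie in
     [St(Y)]. *)
  apply: contrapT => nex; apply: KH => k Kk; split; first exact: KG.
  apply: (invariant_image sgK) => // g x Kg Yx.
  by apply: contrapT => nYgx; apply: nex; exists g; split=> //; exists x.
pose P U := clopen U /\ local_subgroup G U `<=` K.
have PY U : clopen U -> U `<=` ~` Y -> P U.
  by move=> clU UY; split=> // g /(local_subgroup_stabilizer UY)/HK.
have Ppre g U : K g -> P U -> P (homeo_fun g @^-1` U).
  move=> Kg [clU UK]; split; last exact: local_subgroup_preimage.
  by apply: preimage_clopen => //; exact: homeo_fun_continuous.
have Pmeet U V : P U -> P V -> U `&` V !=set0 -> P (U `|` V).
  by move=> [clU UK] [clV VK] UV; split; [exact: clopenU|exact: local_subgroupU].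
have PU : setU_closed P.
  move=> U V PUx PVx.
  have [->|/set0P U0] := eqVneq U set0; first by rewrite set0U.
  have [->|/set0P V0] := eqVneq V set0; first by rewrite setU0.
  have [u Uu nYu] := nowhere_dense_open ndY PUx.1.1 U0.
  have [v Vv nYv] := nowhere_dense_open ndY PVx.1.1 V0.
  have [A [clA Au AU]] := cantor_set_clopen_nbhs XC
    (open_nbhs_nbhs (conj (openI PUx.1.1 oY) (conj Uu nYu))).
  have [B [clB Bv BV]] := cantor_set_clopen_nbhs XC
    (open_nbhs_nbhs (conj (openI PVx.1.1 oY) (conj Vv nYv))).
  (* [U] and [V] may be disjoint. The link [A] joined with [B] misses [Y], meets both, and adds
     nothing to their union, so Property E can be applied twice. *)
  have -> : U `|` V = (U `|` (A `|` B)) `|` V.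
    apply/seteqP; split=> x; first by case; [left; left | right].
    by case=> [[|[/AU[]|/BV[]]]|]; by [left | right].
  apply: (Pmeet _ V) => //; last by exists v; split=> //; right; right.
  apply: (Pmeet U) => //; last by exists u; split=> //; left.
  by apply: PY; [exact: clopenU | move=> x [/AU[]|/BV[]]].
have [W [clW Wky0 WY]] := cantor_set_clopen_nbhs XC
  (open_nbhs_nbhs (conj oY nYky0)).
(* The preimage of [W] under [k] is a member of [P] containing the point [y0] of [Y]; elements of
   [St(Y)] will spread it over [Y]. *)
have PV := Ppre _ _ Kk (PY _ clW WY).
apply: GK => g Gg.
suff [_] : P [set: X] by apply; split=> // x /(_ I).
apply: compact_ideal => //; first exact: cantor_set_compact.
  by apply: PY; [exact: clopen0 | exact: sub0set].
move=> x; have [Yx|nYx] := pselect (Y x); last first.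
  have [U [clU Ux UY]] := cantor_set_clopen_nbhs XC
    (open_nbhs_nbhs (conj oY nYx)).
  by exists U; [exact: PY | apply: open_nbhs_nbhs; split=> //; exact: clU.1].
have [|h Hh Vhx] := minimal_orbit sgH _ Hmin PV.1.1 Yy0 Wky0 Yx.
  by move=> h z [_ hY] Yz; rewrite -hY; exists z.
have PhV := Ppre _ _ (HK _ Hh) PV.
by exists (homeo_fun h @^-1` (homeo_fun k @^-1` W)) => //;
  apply: open_nbhs_nbhs; split=> //; exact: PhV.1.1.
Qed.

Theorem theorem1p3 (X : topologicalType) (G : set (Homeo X)) (Y : set X) :
  cantor_set X ->
  subgroup G -> ample G -> acts_minimally G -> property_E G ->
  infinite_set Y -> closed Y -> nowhere_dense Y ->
  maximal_subgroup G (stabilizer G Y) <->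
  acts_minimally_on (stabilizer G Y) Y.
Proof.
move=> XC sgG aG Gmin EG Yinf cY ndY; split.
  exact: stabilizer_min_of_maximal.
by apply: stabilizer_maximal_of_min => //; exact: infinite_setN0.
Qed.
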